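(* For every integer $n\ge 0$, $$T_{n+2}=\sum_{k=1}^{n}P_{k+2}T_{n-k+2}+P_{n+3},$$ where $T_j$ are the tribonacci numbers and $P_j$ the Padovan numbers.
   Context: Tribonacci numbers: $T_0=T_1=0$, $T_2=1$, $T_n=T_{n-1}+T_{n-2}+T_{n-3}$ for $n\ge3$. Padovan sequence: $P_0=1$, $P_1=P_2=0$, $P_n=P_{n-2}+P_{n-3}$ for $n\ge3$. *)

(* Defs.v *)
From mathcomp Require Import all_boot.

Fixpoint tribonacci (n : nat) : nat :=
  match n with
  | 0 | 1 => 0
  | 2 => 1
  | ((m.+1 as m1).+1 as m2).+1 => tribonacci m2 + tribonacci m1 + tribonacci m
  end.

Fixpoint padovan (n : nat) : nat :=
  match n with
  | 0 => 1
  | 1 | 2 => 0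
  | ((m.+1 as m1).+1).+1 => padovan m1 + padovan m
  end.

(* Main.v *)
Require Import Defs.
From mathcomp Require Import all_boot all_algebra zify.

(** The tribonacci numbers solve the Padovan recurrence
    u_{n+3} = u_{n+1} + u_n + f_n with the forcing term f_n = T_{n+2}. The
    shifted Padovan sequence P_{n+1} starts with 0, 0, 1, so it is the impulse
    response of this recurrence, and it has the same initial values as T. By
    Duhamel's principle T is the sum of this homogeneous solution and of the
    convolution of the impulse response with the forcing term. *)

Set Implicit Arguments.
Unset Strict Implicit.
Unset Printing Implicit Defensive.

Arguments tribonacci : simpl never.
Arguments padovan : simpl never.

Import GRing.Theory.

Section LinearRecurrence.

Local Open Scope ring_scope.

Variables (R : pzSemiRingType) (d : nat) (a : 'I_d.+1 -> R).
Implicit Types f g h r u v : nat -> R.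

Definition solves_recurrence f u : Prop :=
  forall n, u (n + d.+1)%N = \sum_(i < d.+1) a i * u (n + i)%N + f n.

Definition impulse_response r : Prop :=
  [/\ solves_recurrence (fun=> 0) r, forall i, (i < d)%N -> r i = 0 & r d = 1].

(* The index is n - j.+1 because f j first acts on the term of index
   j + d.+1, where the impulse response has to take the value r d = 1. *)
Definition delayed_conv r f n : R := \sum_(j < n) r (n - j.+1)%N * f j.

Lemma solves_recurrenceD f g u v :
  solves_recurrence f u -> solves_recurrence g v ->
  solves_recurrence (fun n => f n + g n) (fun n => u n + v n).
Proof.
move=> uP vP n; rewrite uP vP addrACA -big_split; congr (_ + _).
by apply: eq_bigr => i _; rewrite mulrDr.
Qed.

Lemma solves_recurrence_inj f u v :
  solves_recurrence f u -> solves_recurrence f v ->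
  (forall i, (i <= d)%N -> u i = v i) -> u =1 v.
Proof.
move=> uP vP uv_init; elim/ltn_ind=> n IHn.
have [/uv_init// | lt_dn] := leqP n d.
rewrite -(subnK lt_dn) uP vP; congr (_ + _).
by apply: eq_bigr => i _; rewrite IHn //; have := ltn_ord i; lia.
Qed.

Lemma delayed_conv_addn r f n i :
  (forall j, (j < d)%N -> r j = 0) -> (i <= d)%N ->
  delayed_conv r f (n + i) = \sum_(j < n) r (n - j.+1 + i)%N * f j.
Proof.
move=> r0 le_id; rewrite /delayed_conv big_split_ord /=.
rewrite [X in _ + X]big1 ?addr0 => [|j _]; last first.
  by rewrite r0 ?mul0r //; have := ltn_ord j; lia.
by apply: eq_bigr => j _; rewrite addnBAC.
Qed.

Lemma solves_delayed_conv r f :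
  impulse_response r -> solves_recurrence f (delayed_conv r f).
Proof.
move=> [rP r0 r1] n.
have conv_n (i : 'I_d.+1) : delayed_conv r f (n + i)%N =
    \sum_(j < n) r (n - j.+1 + i)%N * f j.
  by rewrite delayed_conv_addn // -ltnS.
rewrite -addSnnS delayed_conv_addn // big_ord_recr /= subnn r1 mul1r.
congr (_ + _); under [RHS]eq_bigr do rewrite conv_n mulr_sumr.
rewrite exchange_big; apply: eq_bigr => j _ /=.
rewrite subSS -(subnSK (ltn_ord j)) addSnnS rP addr0 mulr_suml.
by under [RHS]eq_bigr do rewrite mulrA.
Qed.

Lemma duhamel r f h u :
    impulse_response r -> solves_recurrence (fun=> 0) h ->
    solves_recurrence f u -> (forall i, (i <= d)%N -> u i = h i) ->
  forall n, u n = h n + delayed_conv r f n.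
Proof.
move=> rP hP uP uh_init; apply: solves_recurrence_inj uP _ _ => [n | i le_id].
  by rewrite (solves_recurrenceD hP (solves_delayed_conv f rP)) add0r.
have [_ r0 _] := rP.
by rewrite -[i]add0n delayed_conv_addn // big_ord0 addr0 uh_init.
Qed.

End LinearRecurrence.

Definition padovan_coef (i : 'I_3) : nat := i < 2.

Lemma solves_padovan_coef (f u : nat -> nat) :
  (forall n, u n.+3 = u n.+1 + u n + f n) ->
  solves_recurrence padovan_coef f u.
Proof.
move=> uS n; rewrite !big_ord_recl big_ord0 /padovan_coef /= !mul1r mul0r !addr0.
by rewrite addn3 uS addn0 addn1 [u n.+1 + u n]addnC.
Qed.

Lemma impulse_response_padovanS :
  impulse_response padovan_coef (fun n => padovan n.+1).
Proof.
split=> [|[|[|i]]|] //.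
by apply: solves_padovan_coef => n; rewrite addn0.
Qed.

Lemma tribonacci_duhamel n :
  tribonacci n = padovan n.+1 + \sum_(j < n) padovan (n - j) * tribonacci j.+2.
Proof.
have [padovanP _ _] := impulse_response_padovanS.
have tribonacciP :
    solves_recurrence padovan_coef (fun n => tribonacci n.+2) tribonacci.
  by apply: solves_padovan_coef => m; rewrite addnC addnA.
rewrite (duhamel impulse_response_padovanS padovanP tribonacciP).
  by congr (_ + _); apply: eq_bigr => j _; rewrite subnSK.
by case=> [|[|[|]]].
Qed.

Theorem theorem17 (n : nat) :
  tribonacci (n + 2) =
    \sum_(1 <= k < n.+1) padovan (k + 2) * tribonacci (n - k + 2)
    + padovan (n + 3).
Proof.
rewrite tribonacci_duhamel addnC addn2 addn3; congr (_ + _).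
rewrite !big_ord_recr /= subSnn -addn2 addKn.
rewrite -[padovan 1]/0 -[padovan 2]/0 !mul0n !addn0.
rewrite big_add1 big_mkord [RHS](reindex_inj rev_ord_inj) /=.
apply: eq_bigr => j _; have lt_jn := ltn_ord j.
by congr (padovan _ * tribonacci _); lia.
Qed.
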